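(* Let the cost structure be separable, let $F(\theta)=\theta$ on $[0,1]$, and suppose that $g(0)=0$, that $g'(q)$ is strictly increasing, and that $\frac{g(q)}{\sqrt{g'(q)}}$ is strictly increasing. Then the buyer's utility $U(k)$ is a quasi-convex function of the number $k\in\{1,\dots,n\}$ of firms allowed to enter. Thus it is optimal for the buyer to allow either one or all firms to enter: $\max_{1\le k\le n}U(k)$ is attained at some $k^*\in\{1,n\}$.
   Context: Separable cost structure: there are $n$ firms with i.i.d. types uniform on $[0,1]$; the buyer's value of quality is $V(q)=q$, the production (winner-pay) cost is $C^P(q,\theta)=\alpha\theta$ with $\alpha>0$ (so the virtual production cost is $2\alpha\theta$), the investment (all-pay) cost is $C^I(q,\theta)=g(q)$ with $g'(q)>0$, $g''(q)>0$ for $q>0$, and $g'(q)>1$ for all large $q$. $U(k)$ is the buyer's expected utility when only $k\le n$ firms are allowed to enter and the optimal symmetric mechanism for these $k$ firms is used: $$U(k)=k\int_0^1\max_{q\ge0}\Big[(q-2\alpha\theta)(1-\theta)^{k-1}-g(q)\Big]\,d\theta .$$ *)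

(* Defs.v *)
(* Real analysis over Stdlib's [R], with Coquelicot. *)
From Stdlib Require Import Reals.
From Coquelicot Require Import Coquelicot.
Open Scope R_scope.

(* [max_{q >= 0} ((q - 2 alpha theta) (1 - theta)^(k-1) - g q)], rendered as a
   supremum.  When [g] is continuous on [0, +oo) with [g'] increasing and
   eventually above 1, and [0 <= theta <= 1], the objective is continuous on [0, +oo) and tends to
   -oo, so the supremum is finite and attained.  The virtual production cost
   [2 alpha theta] is that of [C^P(q, theta) = alpha theta] for uniform types.
   For [k = 1] the power is 1 for every [theta], including [theta = 1]. *)
Definition max_virtual_surplus (g : R -> R) (alpha : R) (k : nat) (theta : R)
  : R :=
  real (Lub_Rbar (fun v : R => exists q : R, 0 <= q /\
    v = (q - 2 * alpha * theta) * (1 - theta) ^ (k - 1) - g q)).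

Definition buyer_utility (g : R -> R) (alpha : R) (k : nat) : R :=
  INR k * RInt (max_virtual_surplus g alpha k) 0 1.

(* Quasi-convexity on the integer interval {a, ..., b}. *)
Definition quasi_convex_between (a b : nat) (f : nat -> R) : Prop :=
  forall i j k : nat, (a <= i)%nat -> (i <= j)%nat -> (j <= k)%nat ->
    (k <= b)%nat -> f j <= Rmax (f i) (f k).

(* Main.v *)
Require Import Defs.
From Stdlib Require Import Reals Ranalysis5 Lra Lia.
From Coquelicot Require Import Coquelicot.
Open Scope R_scope.

(** Let [h] be the convex conjugate of [g]. The substitution [t = 1 - theta] gives
    [U k = k * int_0^1 h (t^(k-1)) dt - 2 * alpha / (k+1)].
    With [x = g' q] the envelope formula gives
    [x h'(x) - h x = g q], so [g / sqrt g'] increasing says that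
    [y |-> h (y^2) / y] is convex on (0, 1].  Under this condition [U] is convex as a
    function of [1 / (k+1)], hence quasi-convex in [k].  Indeed, for [i < j < k] with
    [1 / (j+1)] a convex combination of [1 / (i+1)] and [1 / (k+1)], the matching
    combination of the three integrals is, after a change of variable, an
    integral of [h] against a trinomial of sign pattern +, -, + which
    annihilates [x] and [sqrt x].  Subtracting from [h] the function
    [a x + b sqrt x] that agrees with it at the two sign changes makes the
    integrand nonnegative. *)

(** * Mean value arguments and the sign pattern of trinomials *)

Lemma derive_mvt (f df : R -> R) (a b : R) :
  a < b -> (forall x, a <= x <= b -> is_derive f x (df x)) ->
  exists c, a < c < b /\ f b - f a = df c * (b - a).
Proof.
  intros Hab Hd.
  destruct (MVT_cor2 f df a b Hab) as [c [Hc1 Hc2]].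
  - intros c Hc. apply is_derive_Reals. now apply Hd.
  - exists c. split; assumption.
Qed.

Lemma min_of_derive_sign (f df : R -> R) (c : R) :
  0 < c -> (forall q, 0 < q -> is_derive f q (df q)) ->
  (forall q, 0 < q -> 0 <= df q * (q - c)) ->
  forall q, 0 < q -> f c <= f q.
Proof.
  intros Hc Hd Hs q Hq.
  destruct (Rtotal_order q c) as [H|[H|H]].
  - destruct (derive_mvt f df q c H) as [x [Hx Ex]].
    { intros; apply Hd; lra. }
    assert (0 <= df x * (x - c)) by (apply Hs; lra). nra.
  - subst; lra.
  - destruct (derive_mvt f df c q H) as [x [Hx Ex]].
    { intros; apply Hd; lra. }
    assert (0 <= df x * (x - c)) by (apply Hs; lra). nra.
Qed.

(** If [T v] were nonnegative, [T'] would be positive somewhere in (u, v) and negative somewhere in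
    (v, w). But [T'] is [x ^ b] times a function nondecreasing in [x > 0], so it cannot pass from
    positive to negative. *)
Lemma trinomial_neg_between (c1 c2 c3 : R) (b d : nat) (u v w : R) :
  0 <= c1 -> 0 < c2 -> 0 < u -> u < v -> v < w ->
  let T := fun x => c1 * x ^ (S b + d) + c3 - c2 * x ^ (S b) in
  T u < 0 -> T w < 0 -> T v < 0.
Proof.
  intros H1 H2 Hu Huv Hvw T Tu Tw.
  destruct (Rlt_le_dec (T v) 0) as [|Hv]; [assumption|exfalso].
  set (dT := fun x => x ^ b * (c1 * INR (S b + d) * x ^ d - c2 * INR (S b))).
  assert (Hd : forall x, is_derive T x (dT x)).
  { intros x. unfold T, dT. auto_derive; [easy|].
    replace (Init.Nat.pred (S b + d)) with (b + d)%nat by lia.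
    rewrite pow_add. simpl. ring. }
  destruct (derive_mvt T dT v w Hvw) as [x [Hx Ex]]; [intros; apply Hd|].
  destruct (derive_mvt T dT u v Huv) as [y [Hy Ey]]; [intros; apply Hd|].
  assert (dTx : dT x < 0) by nra.
  assert (dTy : 0 < dT y) by nra.
  unfold dT in dTx, dTy.
  assert (0 < x ^ b) by (apply pow_lt; lra).
  assert (0 < y ^ b) by (apply pow_lt; lra).
  assert (y ^ d <= x ^ d) by (apply pow_incr; lra).
  assert (0 <= INR (S b + d)) by apply pos_INR.
  assert (c1 * INR (S b + d) * y ^ d <= c1 * INR (S b + d) * x ^ d)
    by (apply Rmult_le_compat_l; [apply Rmult_le_pos|]; assumption).
  set (X := c1 * INR (S b + d) * x ^ d - c2 * INR (S b)) in *.
  set (Y := c1 * INR (S b + d) * y ^ d - c2 * INR (S b)) in *.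
  assert (Y <= X) by (unfold X, Y; lra).
  apply (Rlt_not_le _ _ dTx), Rmult_le_pos; [lra|].
  apply Rnot_lt_le. intros HX.
  assert (0 < y ^ b * - Y) by (apply Rmult_lt_0_compat; lra). lra.
Qed.

(** Dividing by [v ^ e3] leaves a trinomial [T] whose negative set in (0, 1] is an interval; [A] and
    [B] are its infimum and supremum. The positive constant term [c3] keeps [A] away from 0. *)
Lemma trinomial_sign (c1 c2 c3 : R) (e1 e2 e3 : nat) :
  0 <= c1 -> 0 < c2 -> 0 < c3 -> (e3 < e2)%nat -> (e2 < e1)%nat ->
  exists A B, 0 < A /\ A <= B /\ B <= 1 /\ forall v, 0 < v <= 1 ->
    (v < A \/ B < v -> 0 <= c1 * v ^ e1 + c3 * v ^ e3 - c2 * v ^ e2) /\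
    (A < v < B -> c1 * v ^ e1 + c3 * v ^ e3 - c2 * v ^ e2 <= 0).
Proof.
  intros H1 H2 H3 E32 E21.
  set (b := (e2 - e3 - 1)%nat). set (d := (e1 - e2)%nat).
  set (T := fun x => c1 * x ^ (S b + d) + c3 - c2 * x ^ (S b)).
  assert (EW : forall v, c1 * v ^ e1 + c3 * v ^ e3 - c2 * v ^ e2 = v ^ e3 * T v).
  { intros v. unfold T.
    replace e1 with (e3 + (S b + d))%nat by (unfold b, d; lia).
    replace e2 with (e3 + S b)%nat at 1 by (unfold b; lia).
    rewrite !(pow_add v e3). ring. }
  assert (Hlow : forall v, 0 < v <= 1 -> T v < 0 -> c3 / c2 <= v).
  { intros v Hv HT. unfold T in HT.
    assert (0 <= v ^ (S b + d)) by (apply pow_le; lra).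
    assert (v ^ b <= 1) by (rewrite <- (pow1 b); apply pow_incr; lra).
    assert (0 <= v ^ b) by (apply pow_le; lra).
    assert (0 <= c1 * v ^ (S b + d)) by nra.
    assert (v ^ S b <= v) by (simpl; nra).
    apply (Rmult_le_reg_l c2); [lra|].
    replace (c2 * (c3 / c2)) with c3 by (field; lra). nra. }
  destruct (Classical_Prop.classic (exists v, 0 < v <= 1 /\ T v < 0)) as [[v0 [Hv0 Tv0]]|Hn].
  - destruct (completeness (fun v => 0 < v <= 1 /\ T v < 0)) as [B [HB1 HB2]].
    { exists 1. intros x Hx. lra. }
    { exists v0. tauto. }
    (* The infimum is obtained as minus the supremum of the mirrored set. *)
    destruct (completeness (fun v => 0 < - v <= 1 /\ T (- v) < 0)) as [A [HA1 HA2]].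
    { exists 0. intros x Hx. lra. }
    { exists (- v0). rewrite Ropp_involutive. tauto. }
    assert (A <= - (c3 / c2)).
    { apply HA2. intros x [Hx Tx]. apply Hlow in Tx; lra. }
    assert (0 < c3 / c2) by (apply Rdiv_lt_0_compat; lra).
    assert (- v0 <= A) by (apply HA1; rewrite Ropp_involutive; tauto).
    assert (v0 <= B) by (apply HB1; tauto).
    assert (B <= 1) by (apply HB2; intros x Hx; lra).
    exists (- A), B. repeat split; try lra; rewrite EW.
    + intros Hv. apply Rmult_le_pos; [apply pow_le; lra|].
      apply Rnot_lt_le. intros HT. destruct Hv as [Hv|Hv].
      * assert (- v <= A); [|lra]. apply HA1. rewrite Ropp_involutive. tauto.
      * assert (v <= B); [|lra]. apply HB1. tauto.
    + intros Hv.
      assert (T v < 0).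
      { assert (exists u, u < v /\ 0 < u <= 1 /\ T u < 0) as [u Hu].
        { apply Classical_Prop.NNPP. intros Hno.
          assert (A <= - v); [|lra]. apply HA2. intros x Hx.
          apply Rnot_lt_le. intros Hlt. apply Hno. exists (- x).
          split; [lra|exact Hx]. }
        assert (exists w, v < w /\ 0 < w <= 1 /\ T w < 0) as [w Hw].
        { apply Classical_Prop.NNPP. intros Hno.
          assert (B <= v); [|lra]. apply HB2. intros x Hx.
          apply Rnot_lt_le. intros Hlt. apply Hno. exists x.
          split; [lra|exact Hx]. }
        apply (trinomial_neg_between c1 c2 c3 b d u v w); try lra; tauto. }
      assert (0 < v ^ e3) by (apply pow_lt; lra). nra.
  (* [T] is nowhere negative: [A = B] makes the middle interval empty. *)
  - exists 1, 1. repeat split; try lra.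
    intros _. rewrite EW. apply Rmult_le_pos; [apply pow_le; lra|].
    apply Rnot_lt_le. intros HT. apply Hn. exists v. split; assumption.
Qed.

(** * Convexity in the square root of the variable *)

(* The support lines of the convex function [y |-> f (y ^ 2) / y] on (0, 1],
   written in the variable [x = y ^ 2]. *)
Definition sqrt_convex (f : R -> R) : Prop :=
  forall x0, 0 < x0 <= 1 -> exists a b, f x0 = a * x0 + b * sqrt x0 /\
    forall x, 0 < x <= 1 -> a * x + b * sqrt x <= f x.

Lemma sqrt_convex_support (f : R -> R) (y0 : R) :
  sqrt_convex f -> 0 < y0 <= 1 ->
  exists a b, f (y0 ^ 2) / y0 = a * y0 + b /\
    forall y, 0 < y <= 1 -> a * y + b <= f (y ^ 2) / y.
Proof.
  intros Hf Hy0.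
  destruct (Hf (y0 ^ 2)) as [a [b [E H]]]; [simpl; nra|].
  exists a, b. split.
  - rewrite E, sqrt_pow2 by lra. field. lra.
  - intros y Hy. specialize (H (y ^ 2)). rewrite sqrt_pow2 in H by lra.
    apply (Rmult_le_reg_r y); [lra|].
    replace (f (y ^ 2) / y * y) with (f (y ^ 2)) by (field; lra).
    eapply Rle_trans; [|apply H; simpl; nra]. simpl; nra.
Qed.

(** The line is the chord of [y |-> f (y ^ 2) / y] through [A] and [B]: a convex function lies below
    its chord between the endpoints and above it outside. If [A = B], a support line serves. *)
Lemma sqrt_convex_chord (f : R -> R) (A B : R) :
  sqrt_convex f -> 0 < A -> A <= B -> B <= 1 ->
  exists a b, forall y, 0 < y <= 1 ->
    (A <= y <= B -> f (y ^ 2) <= a * y ^ 2 + b * y) /\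
    (y <= A \/ B <= y -> a * y ^ 2 + b * y <= f (y ^ 2)).
Proof.
  intros Hf HA HAB HB. set (G := fun y => f (y ^ 2) / y).
  enough (exists a b, forall y, 0 < y <= 1 ->
    (A <= y <= B -> G y <= a * y + b) /\
    (y <= A \/ B <= y -> a * y + b <= G y)) as [a [b H]].
  { exists a, b. intros y Hy. destruct (H y Hy) as [H1 H2].
    assert (E : f (y ^ 2) = G y * y) by (unfold G; field; lra).
    split; intros Hc; rewrite E.
    - specialize (H1 Hc). simpl; nra.
    - specialize (H2 Hc). simpl; nra. }
  destruct (sqrt_convex_support f A Hf) as [aA [bA [EA SA]]]; [lra|].
  destruct (sqrt_convex_support f B Hf) as [aB [bB [EB SB]]]; [lra|].
  destruct HAB as [HAB|HAB].
  - set (a := (G B - G A) / (B - A)).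
    assert (Ea : G B = G A + a * (B - A)) by (unfold a; field; lra).
    exists a, (G A - a * A). intros y Hy. split; intros Hc.
    + destruct (sqrt_convex_support f y Hf Hy) as [c [d [E S]]].
      pose proof (S A ltac:(lra)) as S1. pose proof (S B ltac:(lra)) as S2.
      fold (G y) in E. fold (G A) in S1. fold (G B) in S2. nra.
    (* [S3] and [S4] place the chord's slope between those of the support lines at [A] and at [B],
       so outside [A, B] these lie above the chord. *)
    + pose proof (SA y Hy) as S1. pose proof (SB y Hy) as S2.
      pose proof (SA B ltac:(lra)) as S3. pose proof (SB A ltac:(lra)) as S4.
      fold (G y) in S1, S2. fold (G A) in EA, S4. fold (G B) in EB, S3.
      destruct Hc; nra.
  - exists aA, bA. intros y Hy. split; intros Hc.
    + replace y with A by lra. unfold G. lra.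
    + apply SA; lra.
Qed.

(** * Integrals of [f (t ^ m)] and their convexity in [1 / (m + 2)] *)

Definition power_mean (f : R -> R) (m : nat) : R :=
  INR (S m) * RInt (fun t => f (t ^ m)) 0 1.

Lemma is_derive_monomial (n : nat) (x : R) :
  is_derive (fun t : R => t ^ n) x (INR n * x ^ (n - 1)).
Proof.
  auto_derive; [easy|]. rewrite Nat.sub_1_r. ring.
Qed.

Lemma continuous_pow (n : nat) (x : R) : continuous (fun t : R => t ^ n) x.
Proof.
  apply (ex_derive_continuous (K := R_AbsRing) (V := R_NormedModule)).
  eexists. apply is_derive_monomial.
Qed.

Lemma ex_RInt_comp_pow (f : R -> R) (m : nat) :
  (forall x, continuous f x) -> ex_RInt (fun t => f (t ^ m)) 0 1.
Proof.
  intros Hf. apply (ex_RInt_continuous (V := R_CompleteNormedModule)). intros z _.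
  apply (continuous_comp (fun t : R => t ^ m) f); [apply continuous_pow|apply Hf].
Qed.

(** Substitution [t = v ^ (2 * d)]. Choosing [d] suitably gives different [m] the same argument of
    [f]; the even exponent makes the square root of that argument a power of [v]. *)
Lemma power_mean_subst (f : R -> R) (m d : nat) :
  (forall x, continuous f x) -> (0 < d)%nat ->
  is_RInt (fun v => INR (S m) * INR (2 * d) * v ^ (2 * d - 1) * f ((v ^ (m * d)) ^ 2))
    0 1 (power_mean f m).
Proof.
  intros Hf Hd.
  assert (H : is_RInt (fun v : R => scal (INR (2 * d) * v ^ (2 * d - 1))
      (f ((v ^ (2 * d)) ^ m))) 0 1 (RInt (fun t => f (t ^ m)) (0 ^ (2 * d)) (1 ^ (2 * d)))).
  { apply (is_RInt_comp (V := R_CompleteNormedModule) (fun t => f (t ^ m)) (fun v : R => v ^ (2 * d))).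
    - intros x _. apply (continuous_comp (fun t : R => t ^ m) f); [apply continuous_pow|apply Hf].
    - intros x _. split.
      + apply is_derive_monomial.
      + apply (continuous_mult (K := R_AbsRing)); [apply continuous_const|apply continuous_pow]. }
  rewrite pow1, pow_i in H by lia.
  apply (is_RInt_scal _ _ _ (INR (S m))) in H.
  unfold power_mean. eapply is_RInt_ext; [|exact H].
  intros v _. rewrite <- !pow_mult.
  replace (2 * d * m)%nat with (m * d * 2)%nat by lia.
  unfold scal; simpl; unfold mult; simpl. ring.
Qed.

Lemma is_RInt_pow_01 (n : nat) : is_RInt (fun t => t ^ n) 0 1 (/ INR (S n)).
Proof.
  assert (Hn : INR (S n) <> 0) by (apply not_0_INR; lia).
  assert (H : is_RInt (fun t => t ^ n) 0 1
    (minus (1 ^ S n / INR (S n)) (0 ^ S n / INR (S n)))).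
  { apply (is_RInt_derive (V := R_CompleteNormedModule) (fun t : R => t ^ S n / INR (S n))).
    - intros x _. auto_derive; [easy|]. simpl Init.Nat.pred. field. assumption.
    - intros x _. apply continuous_pow. }
  rewrite pow1, pow_i in H by lia.
  replace (/ INR (S n)) with (minus (1 / INR (S n)) (0 / INR (S n))); [exact H|].
  change (1 / INR (S n) - 0 / INR (S n) = / INR (S n)). field. assumption.
Qed.

Lemma power_mean_sqrt (m : nat) : power_mean sqrt m = 2 * (1 - / INR (m + 2)).
Proof.
  assert (H := power_mean_subst sqrt m 1 continuous_sqrt ltac:(lia)).
  assert (H2 := is_RInt_scal _ _ _ (INR (S m) * INR 2) _ (is_RInt_pow_01 (S m))).
  apply (is_RInt_unique (V := R_CompleteNormedModule)) in H2. rewrite <- (is_RInt_unique _ _ _ _ H).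
  rewrite (RInt_ext _ (fun v => INR (S m) * INR 2 * v ^ S m)).
  - transitivity (INR (S m) * INR 2 * / INR (S (S m))); [exact H2|].
    rewrite plus_INR, !S_INR. pose proof (pos_INR m). simpl. field. lra.
  - rewrite Rmin_left, Rmax_right by lra. intros v Hv.
    rewrite sqrt_pow2 by (apply pow_le; lra).
    replace (2 * 1 - 1)%nat with 1%nat by lia. rewrite Nat.mul_1_r.
    rewrite Nat.mul_1_r, pow_1, <- tech_pow_Rmult. apply Rmult_assoc.
Qed.

(** The mean of [a x + b sqrt x] is affine in [1 / (m + 2)], so a convex combination matched in
    [1 / (m + 2)] does not see it. *)
Lemma power_mean_sub_sqrt (f : R -> R) (a b : R) (m : nat) :
  (forall x, continuous f x) ->
  power_mean (fun x => f x - (a * x + b * sqrt x)) m =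
  power_mean f m - (a + b * (2 * (1 - / INR (m + 2)))).
Proof.
  intros Hf. rewrite <- power_mean_sqrt. unfold power_mean.
  assert (Hn : INR (S m) <> 0) by (apply not_0_INR; lia).
  assert (Hs : is_RInt (fun t => sqrt (t ^ m)) 0 1 (RInt (fun t => sqrt (t ^ m)) 0 1)).
  { apply (RInt_correct (V := R_CompleteNormedModule)). apply (ex_RInt_comp_pow sqrt). apply continuous_sqrt. }
  assert (Hff := RInt_correct _ _ _ (ex_RInt_comp_pow f m Hf)).
  assert (H := is_RInt_minus _ _ _ _ _ _ Hff
    (is_RInt_plus _ _ _ _ _ _ (is_RInt_scal _ _ _ a _ (is_RInt_pow_01 m))
       (is_RInt_scal _ _ _ b _ Hs))).
  apply (is_RInt_unique (V := R_CompleteNormedModule)) in H.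
  replace (RInt (fun t => f (t ^ m) - (a * t ^ m + b * sqrt (t ^ m))) 0 1) with
    (RInt (fun t => f (t ^ m)) 0 1 - (a * / INR (S m) + b * RInt (fun t => sqrt (t ^ m)) 0 1)).
  field. assumption.
Qed.

(** The chord through the sign changes of the trinomial makes [r] change sign exactly where the
    trinomial does, so the product is nonnegative. The point 1 lies outside the open interval of
    sign change, hence [0 <= r 1]. *)
Lemma sqrt_convex_test (f : R -> R) (c1 c2 c3 : R) (e1 e2 e3 N : nat) :
  sqrt_convex f ->
  0 <= c1 -> 0 < c2 -> 0 < c3 -> (e3 < e2)%nat -> (e2 < e1)%nat -> (0 < N)%nat ->
  exists a b, let r := fun x => f x - (a * x + b * sqrt x) in
    0 <= r 1 /\ forall v, 0 < v < 1 ->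
    0 <= (c1 * v ^ e1 + c3 * v ^ e3 - c2 * v ^ e2) * r ((v ^ N) ^ 2).
Proof.
  intros Hf H1 H2 H3 E32 E21 HN.
  destruct (trinomial_sign c1 c2 c3 e1 e2 e3) as [A [B [HA [HAB [HB HW]]]]]; try assumption.
  assert (P : forall x, 0 < x <= 1 -> 0 < x ^ N <= 1).
  { intros x Hx. split; [apply pow_lt; lra|]. rewrite <- (pow1 N). apply pow_incr; lra. }
  assert (M : forall x y, 0 < x -> x <= y -> x ^ N <= y ^ N).
  { intros x y Hx Hxy. apply pow_incr; lra. }
  destruct (sqrt_convex_chord f (A ^ N) (B ^ N) Hf) as [a [b HL]].
  { apply P; lra. } { apply M; lra. } { apply P; lra. }
  exists a, b. intros r. split.
  - destruct (HL 1 ltac:(lra)) as [_ HL1].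
    unfold r. rewrite sqrt_1. specialize (HL1 (or_intror (proj2 (P B ltac:(lra))))).
    rewrite pow1 in HL1. lra.
  - intros v Hv. unfold r. rewrite sqrt_pow2 by (apply pow_le; lra).
    destruct (HL (v ^ N) (P v ltac:(lra))) as [Hin Hout].
    destruct (HW v ltac:(lra)) as [Wout Win].
    destruct (Rlt_le_dec v A) as [vA|Av].
    { specialize (Wout (or_introl vA)). specialize (Hout (or_introl (M v A ltac:(lra) ltac:(lra)))).
      apply Rmult_le_pos; lra. }
    destruct (Rlt_le_dec B v) as [Bv|vB].
    { specialize (Wout (or_intror Bv)). specialize (Hout (or_intror (M B v ltac:(lra) ltac:(lra)))).
      apply Rmult_le_pos; lra. }
    (* At [v = A] or [v = B] both bounds of the chord lemma apply and [r] vanishes, so the sign of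
       the trinomial there does not matter. *)
    specialize (Hin (conj (M A v HA Av) (M v B ltac:(lra) vB))).
    destruct (Rle_lt_or_eq_dec _ _ Av) as [Av'| <-].
    + destruct (Rle_lt_or_eq_dec _ _ vB) as [vB'| ->].
      * specialize (Win (conj Av' vB')). rewrite <- Rmult_opp_opp.
        apply Rmult_le_pos; lra.
      * specialize (Hout (or_intror (Rle_refl _))).
        rewrite (Rle_antisym _ _ Hin Hout). lra.
    + specialize (Hout (or_introl (Rle_refl _))).
      rewrite (Rle_antisym _ _ Hin Hout). lra.
Qed.

(* In the variable [v] with [t = v ^ (2 d)], [d] depending on [m], all three integrals are taken
   against [f (v ^ (2 N))], so that only the sign of a trinomial matters. *)
Lemma power_mean_convex (f : R -> R) (m1 m2 m3 : nat) (l1 l3 : R) :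
  (forall x, continuous f x) -> sqrt_convex f ->
  (m1 < m2)%nat -> (m2 < m3)%nat -> 0 < l1 -> 0 < l3 -> l1 + l3 = 1 ->
  l1 / INR (m1 + 2) + l3 / INR (m3 + 2) = / INR (m2 + 2) ->
  power_mean f m2 <= l1 * power_mean f m1 + l3 * power_mean f m3.
Proof.
  intros Hc Hf M12 M23 L1 L3 L13 EL.
  set (C := fun m d => INR (S m) * INR (2 * d)).
  assert (CP : forall m d, (0 < d)%nat -> 0 < C m d).
  { intros m d Hd. apply Rmult_lt_0_compat; apply lt_0_INR; lia. }
  (* By [EL] and [l1 + l3 = 1], replacing [f] by [r] leaves the combination unchanged. *)
  enough (exists a b, let r := fun x => f x - (a * x + b * sqrt x) in
    0 <= l1 * power_mean r m1 + l3 * power_mean r m3 - power_mean r m2) as [a [b H]].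
  { cbv zeta in H. rewrite !power_mean_sub_sqrt in H by assumption.
    assert (l1 * (a + b * (2 * (1 - / INR (m1 + 2)))) + l3 * (a + b * (2 * (1 - / INR (m3 + 2))))
      = a + b * (2 * (1 - / INR (m2 + 2)))).
    { rewrite <- EL. replace l3 with (1 - l1) by lra. unfold Rdiv. ring. }
    lra. }
  assert (Hr : forall a b x, continuous (fun x => f x - (a * x + b * sqrt x)) x).
  { intros a b x. apply (continuous_minus (K := R_AbsRing) (V := R_NormedModule)); [apply Hc|].
    apply (continuous_plus (K := R_AbsRing) (V := R_NormedModule)).
    - apply (continuous_mult (K := R_AbsRing)); [apply continuous_const|apply continuous_id].
    - apply (continuous_mult (K := R_AbsRing)); [apply continuous_const|apply continuous_sqrt]. }
  (* For [m1 = 0] no substitution gives a common argument, but [f (t ^ 0)] is constant and its mean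
     is [r 1]. The trinomial keeps only the two other terms: its leading coefficient is 0, with
     [2 * m3] as a placeholder exponent above [e2]. *)
  destruct m1 as [|m].
  - destruct (sqrt_convex_test f 0 (C m2 m3) (l3 * C m3 m2) (2 * m3)
      (2 * m3 - 1) (2 * m2 - 1) (m2 * m3)) as [a [b [R1 HW]]]; try lia; try assumption; try lra.
    { apply CP; lia. }
    { apply Rmult_lt_0_compat; [|apply CP]; [lra|lia]. }
    { nia. }
    exists a, b. intros r.
    assert (E0 : power_mean r 0 = r 1).
    { unfold power_mean. simpl pow. rewrite RInt_const.
      change (1 * ((1 - 0) * r 1) = r 1). ring. }
    assert (H2 := power_mean_subst r m2 m3 (Hr a b) ltac:(lia)).
    assert (H3 := power_mean_subst r m3 m2 (Hr a b) ltac:(lia)).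
    assert (H := is_RInt_minus _ _ _ _ _ _ (is_RInt_scal _ _ _ l3 _ H3) H2).
    assert (0 <= l3 * power_mean r m3 - power_mean r m2).
    { eapply Rle_trans; [|apply Req_le, (is_RInt_unique (V := R_CompleteNormedModule) _ _ _ _ H)].
      apply RInt_ge_0; [lra|eexists; exact H|].
      intros v Hv. specialize (HW v Hv). fold r in HW.
      replace (m3 * m2)%nat with (m2 * m3)%nat by lia.
      eapply Rle_trans; [exact HW|]. apply Req_le.
      set (x := r ((v ^ (m2 * m3)) ^ 2)).
      change ((0 * v ^ (2 * m3) + l3 * C m3 m2 * v ^ (2 * m2 - 1) - C m2 m3 * v ^ (2 * m3 - 1)) * x
        = l3 * (C m3 m2 * v ^ (2 * m2 - 1) * x) - C m2 m3 * v ^ (2 * m3 - 1) * x). ring. }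
    rewrite E0. assert (0 <= l1 * r 1) by (apply Rmult_le_pos; [lra|exact R1]). lra.
  - set (m1 := S m) in *.
    (* Each [d] is the product of the two other indices, so the common argument is
       [(v ^ (m1 * m2 * m3)) ^ 2], and [m1 < m2 < m3] puts the negative coefficient at the middle
       exponent. *)
    destruct (sqrt_convex_test f (l1 * C m1 (m2 * m3)%nat) (C m2 (m1 * m3)%nat)
      (l3 * C m3 (m1 * m2)%nat) (2 * (m2 * m3) - 1) (2 * (m1 * m3) - 1) (2 * (m1 * m2) - 1)
      (m1 * m2 * m3)) as [a [b [_ HW]]]; try assumption.
    { apply Rmult_le_pos; [lra|]. apply Rlt_le, CP. unfold m1; nia. }
    { apply CP; unfold m1; nia. }
    { apply Rmult_lt_0_compat; [lra|]. apply CP. unfold m1; nia. }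
    { unfold m1 in *; nia. }
    { unfold m1 in *; nia. }
    { unfold m1 in *; nia. }
    exists a, b. intros r.
    assert (H1 := power_mean_subst r m1 (m2 * m3) (Hr a b) ltac:(unfold m1; nia)).
    assert (H2 := power_mean_subst r m2 (m1 * m3) (Hr a b) ltac:(unfold m1; nia)).
    assert (H3 := power_mean_subst r m3 (m1 * m2) (Hr a b) ltac:(unfold m1; nia)).
    assert (H := is_RInt_minus _ _ _ _ _ _ (is_RInt_plus _ _ _ _ _ _
      (is_RInt_scal _ _ _ l1 _ H1) (is_RInt_scal _ _ _ l3 _ H3)) H2).
    eapply Rle_trans; [|apply Req_le, (is_RInt_unique (V := R_CompleteNormedModule) _ _ _ _ H)].
    apply RInt_ge_0; [lra|eexists; exact H|].
    intros v Hv. specialize (HW v Hv). fold r in HW.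
    replace (m1 * (m2 * m3))%nat with (m1 * m2 * m3)%nat by lia.
    replace (m2 * (m1 * m3))%nat with (m1 * m2 * m3)%nat by lia.
    replace (m3 * (m1 * m2))%nat with (m1 * m2 * m3)%nat by lia.
    eapply Rle_trans; [exact HW|]. apply Req_le.
    set (x := r ((v ^ (m1 * m2 * m3)) ^ 2)).
    set (w1 := v ^ (2 * (m2 * m3) - 1)). set (w2 := v ^ (2 * (m1 * m3) - 1)).
    set (w3 := v ^ (2 * (m1 * m2) - 1)).
    change ((l1 * C m1 (m2 * m3)%nat * w1 + l3 * C m3 (m1 * m2)%nat * w3 - C m2 (m1 * m3)%nat * w2) * x
      = l1 * (C m1 (m2 * m3)%nat * w1 * x) + l3 * (C m3 (m1 * m2)%nat * w3 * x)
        - C m2 (m1 * m3)%nat * w2 * x). ring.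
Qed.

(** * The convex conjugate of the investment cost *)

(* The bound [Q] makes the conjugate finite and Lipschitz on all of [R]. *)
Definition conjugate (g : R -> R) (Q x : R) : R :=
  real (Lub_Rbar (fun v : R => exists q : R, 0 <= q <= Q /\ v = q * x - g q)).

(** [real] would send an infinite supremum to 0, so finiteness comes first: the values are bounded
    by [Q * Rabs x], and [q = 0] contributes one. *)
Lemma conjugate_lub (g : R -> R) (Q x : R) :
  0 <= Q -> (forall q, 0 <= q -> 0 <= g q) ->
  (forall q, 0 <= q <= Q -> q * x - g q <= conjugate g Q x) /\
  (forall M, (forall q, 0 <= q <= Q -> q * x - g q <= M) -> conjugate g Q x <= M).
Proof.
  intros HQ Hg. unfold conjugate.
  destruct (Lub_Rbar_correct (fun v => exists q, 0 <= q <= Q /\ v = q * x - g q)) as [Hub Hl].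
  set (L := Lub_Rbar _) in *.
  assert (H0 : Rbar_le (0 * x - g 0) L) by (apply Hub; exists 0; split; [lra|reflexivity]).
  assert (HB : Rbar_le L (Q * Rabs x)).
  { apply Hl. intros v [q [Hq ->]]. simpl.
    specialize (Hg q (proj1 Hq)). pose proof (Rle_abs x). pose proof (Rabs_pos x). nra. }
  destruct L as [l| |]; simpl in *; try contradiction.
  split.
  - intros q Hq. apply (Hub (q * x - g q)). exists q. split; [assumption|reflexivity].
  - intros M HM. apply (Hl (Finite M)). intros v [q [Hq ->]]. apply HM, Hq.
Qed.

Lemma conjugate_continuous (g : R -> R) (Q x : R) :
  0 <= Q -> (forall q, 0 <= q -> 0 <= g q) -> continuous (conjugate g Q) x.
Proof.
  intros HQ Hg.
  assert (L : forall x y, conjugate g Q x <= conjugate g Q y + Q * Rabs (x - y)).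
  { intros y z. apply conjugate_lub; try assumption. intros q Hq.
    pose proof (proj1 (conjugate_lub g Q z HQ Hg) q Hq).
    pose proof (Rle_abs (y - z)). pose proof (Rabs_pos (y - z)).
    assert (q * (y - z) <= Q * Rabs (y - z)) by nra. lra. }
  apply continuity_pt_filterlim, continuity_pt_locally. intros eps.
  assert (He : 0 < eps / (Q + 1)) by (apply Rdiv_lt_0_compat; [apply cond_pos|lra]).
  exists (mkposreal _ He). intros y Hy. change (Rabs (y - x) < eps / (Q + 1)) in Hy.
  pose proof (L x y) as L1. pose proof (L y x) as L2. rewrite Rabs_minus_sym in L1.
  assert (Q * Rabs (y - x) < eps).
  { apply (Rmult_lt_compat_l (Q + 1)) in Hy; [|lra].
    replace ((Q + 1) * (eps / (Q + 1))) with (pos eps) in Hy by (field; lra).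
    pose proof (Rabs_pos (y - x)). nra. }
  apply Rabs_def1; lra.
Qed.

(** The derivative hypotheses concern only positive [q]; this point close to 0 stands in for the
    endpoint. *)
Lemma small_near_zero (g : R -> R) (b eps c : R) :
  filterlim g (at_right 0) (locally (g 0)) -> g 0 = 0 -> 0 < eps -> 0 < c ->
  exists q, 0 < q < c /\ Rabs (g q + b * q) < eps.
Proof.
  intros Hg g0 He Hc. rewrite g0 in Hg.
  assert (He2 : 0 < eps / 2) by lra.
  destruct (Hg (ball 0 (mkposreal _ He2)) (locally_ball 0 (mkposreal _ He2))) as [d Hd].
  assert (Hb : 0 < eps / 2 / (Rabs b + 1)).
  { apply Rdiv_lt_0_compat; [lra|]. pose proof (Rabs_pos b); lra. }
  pose proof (cond_pos d).
  set (q := Rmin (Rmin (d / 2) (c / 2)) (eps / 2 / (Rabs b + 1))).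
  assert (Hq : 0 < q) by (unfold q; repeat apply Rmin_pos; lra).
  assert (q <= d / 2) by (unfold q; eapply Rle_trans; [apply Rmin_l|apply Rmin_l]).
  assert (q <= c / 2) by (unfold q; eapply Rle_trans; [apply Rmin_l|apply Rmin_r]).
  assert (Hqb : q <= eps / 2 / (Rabs b + 1)) by apply Rmin_r.
  exists q. split; [lra|].
  assert (G : Rabs (g q - 0) < eps / 2).
  { apply Hd; [|assumption]. change (Rabs (q - 0) < d). rewrite Rabs_right; lra. }
  rewrite Rminus_0_r in G.
  assert (Rabs (b * q) <= eps / 2).
  { rewrite Rabs_mult, (Rabs_right q) by lra. pose proof (Rabs_pos b).
    apply (Rmult_le_compat_l (Rabs b + 1)) in Hqb; [|lra].
    replace ((Rabs b + 1) * (eps / 2 / (Rabs b + 1))) with (eps / 2) in Hqb by (field; lra).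
    nra. }
  pose proof (Rabs_triang (g q) (b * q)). lra.
Qed.

(** [g q - x * q] is nondecreasing for [q > 0] and tends to 0 at 0. *)
Lemma slope_le_growth (g : R -> R) (x : R) :
  filterlim g (at_right 0) (locally (g 0)) -> g 0 = 0 ->
  (forall q, 0 < q -> ex_derive g q) -> (forall q, 0 < q -> x <= Derive g q) ->
  forall q, 0 <= q -> x * q <= g q.
Proof.
  intros Hc g0 Hd Hx q [Hq| <-]; [|rewrite g0; lra].
  apply Rnot_lt_le. intros Hlt.
  destruct (small_near_zero g (- x) (x * q - g q) q Hc g0) as [p [Hp Hs]]; [lra|lra|].
  apply Rabs_def2 in Hs.
  destruct (derive_mvt g (Derive g) p q) as [c [Hcc E]]; [lra| |].
  { intros y Hy. apply Derive_correct, Hd; lra. }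
  specialize (Hx c ltac:(lra)). nra.
Qed.

(* [g / g' - 2 r0 / sqrt g'] with [r0 := (g / sqrt g') q0] differs from [q] by a
   function whose derivative has the sign of [g / sqrt g' - r0]. *)
Lemma ratio_incr_support (g : R -> R) (q0 q : R) :
  (forall q, 0 < q -> ex_derive g q) ->
  (forall q, 0 < q -> ex_derive (Derive g) q) ->
  (forall q, 0 < q -> 0 < Derive g q) ->
  (forall q, 0 < q -> 0 < Derive (Derive g) q) ->
  (forall p q, 0 < p -> p < q -> g p / sqrt (Derive g p) < g q / sqrt (Derive g q)) ->
  0 < q0 -> 0 < q ->
  q0 + g q0 / Derive g q0 <=
  q - g q / Derive g q + 2 * (g q0 / sqrt (Derive g q0)) / sqrt (Derive g q).
Proof.
  intros H1 H2 D1 D2 Hr Hq0 Hq.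
  set (r0 := g q0 / sqrt (Derive g q0)).
  set (G := fun q => q - g q / Derive g q + 2 * r0 / sqrt (Derive g q)).
  assert (HG : G q0 <= G q).
  { apply (min_of_derive_sign G (fun q => Derive (Derive g) q / (Derive g q * sqrt (Derive g q))
      * (g q / sqrt (Derive g q) - r0)) q0); try assumption.
    - intros x Hx. pose proof (D1 x Hx) as Dx. pose proof (sqrt_lt_R0 _ Dx) as Sx.
      unfold G. auto_derive.
      + repeat split; try lra; try (apply H1; assumption); try (apply H2; assumption); try assumption.
      + change (Derive (fun x : R => g x) x) with (Derive g x).
        change (Derive (fun x : R => Derive g x) x) with (Derive (Derive g) x).
        set (s := sqrt (Derive g x)) in *.
        assert (Es : Derive g x = s * s) by (unfold s; rewrite sqrt_sqrt; lra).
        rewrite Es. field. lra.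
    - intros x Hx. pose proof (D1 x Hx) as Dx. pose proof (sqrt_lt_R0 _ Dx) as Sx.
      pose proof (D2 x Hx) as DDx.
      rewrite Rmult_assoc. apply Rmult_le_pos.
      + apply Rlt_le, Rdiv_lt_0_compat; [assumption|nra].
      + unfold r0. destruct (Rtotal_order x q0) as [H|[->|H]].
        * pose proof (Hr x q0 Hx H). nra.
        * lra.
        * pose proof (Hr q0 x Hq0 H). nra. }
  assert (E : G q0 = q0 + g q0 / Derive g q0).
  { pose proof (D1 q0 Hq0) as Dx. pose proof (sqrt_lt_R0 _ Dx) as Sx.
    unfold G, r0. set (s := sqrt (Derive g q0)) in *.
    assert (Es : Derive g q0 = s * s) by (unfold s; rewrite sqrt_sqrt; lra).
    rewrite Es. field. lra. }
  rewrite <- E. exact HG.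
Qed.

(** If [g'] drops below [x] somewhere, it exceeds [1 >= x] beyond [Q], so the intermediate value
    theorem gives a root, which cannot itself lie beyond [Q]. *)
Lemma marginal_dichotomy (g : R -> R) (Q x : R) :
  (forall q, 0 < q -> ex_derive (Derive g) q) ->
  (forall q, Q < q -> 1 < Derive g q) -> x <= 1 ->
  (forall q, 0 < q -> x <= Derive g q) \/ exists q, 0 < q <= Q /\ Derive g q = x.
Proof.
  intros H2 HQ Hx.
  destruct (Classical_Prop.classic (exists q, 0 < q /\ Derive g q < x)) as [[p [Hp Hpx]]|Hn].
  - right. set (w := Rmax p Q + 1).
    assert (p < w) by (unfold w; pose proof (Rmax_l p Q); lra).
    assert (Q < w) by (unfold w; pose proof (Rmax_r p Q); lra).
    destruct (IVT_interv (fun q => Derive g q - x) p w) as [q [Hq E]]; try lra.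
    + intros a Ha. apply continuity_pt_filterlim.
      apply (ex_derive_continuous (K := R_AbsRing) (V := R_NormedModule)
        (fun q => Derive g q - x)).
      auto_derive. repeat split; try easy. apply H2; lra.
    + specialize (HQ w ltac:(assumption)). lra.
    + exists q. split; [split|]; try lra.
      apply Rnot_lt_le. intros HqQ. specialize (HQ q HqQ). lra.
  - left. intros q Hq. apply Rnot_lt_le. intros H. apply Hn. exists q. split; assumption.
Qed.

Lemma conjugate_sqrt_convex (g : R -> R) (Q : R) :
  filterlim g (at_right 0) (locally (g 0)) -> g 0 = 0 ->
  (forall q, 0 < q -> ex_derive g q) ->
  (forall q, 0 < q -> ex_derive (Derive g) q) ->
  (forall q, 0 < q -> 0 < Derive g q) ->
  (forall q, 0 < q -> 0 < Derive (Derive g) q) ->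
  (forall p q, 0 < p -> p < q -> Derive g p < Derive g q) ->
  (forall p q, 0 < p -> p < q -> g p / sqrt (Derive g p) < g q / sqrt (Derive g q)) ->
  0 <= Q -> (forall q, Q < q -> 1 < Derive g q) ->
  sqrt_convex (conjugate g Q).
Proof.
  intros Hc g0 H1 H2 D1 D2 Hi Hr HQ HQ1 x0 Hx0.
  assert (Hg : forall q, 0 <= q -> 0 <= g q).
  { intros q Hq. rewrite <- (Rmult_0_l q). apply slope_le_growth; try assumption.
    intros; apply Rlt_le, D1; assumption. }
  assert (Hub := fun x => proj1 (conjugate_lub g Q x HQ Hg)).
  assert (Hl := fun x => proj2 (conjugate_lub g Q x HQ Hg)).
  assert (Hpos : forall x, 0 <= conjugate g Q x).
  { intros x. pose proof (Hub x 0 ltac:(lra)) as H. rewrite g0 in H. lra. }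
  destruct (marginal_dichotomy g Q x0 H2 HQ1 (proj2 Hx0)) as [Hflat|[q0 [Hq0 E0]]].
  (* Marginal cost is never below [x0], so the conjugate vanishes at [x0], and the zero line
     supports it because it is nonnegative. *)
  - exists 0, 0. split.
    + apply Rle_antisym; [|pose proof (Hpos x0); lra].
      apply Hl. intros q Hq.
      pose proof (slope_le_growth g x0 Hc g0 H1 Hflat q (proj1 Hq)). lra.
    + intros x _. pose proof (Hpos x). lra.
  - assert (S0 : 0 < sqrt x0) by (apply sqrt_lt_R0; lra).
    (* The tangent of [y |-> h (y ^ 2) / y] at [y0 = sqrt x0]: its slope is [2 h' x0 - h x0 / x0],
       with [h' x0 = q0] and [h x0 = q0 * x0 - g q0]. *)
    exists (q0 + g q0 / x0), (- 2 * (g q0 / sqrt x0)).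
    assert (Hsup : forall q, 0 < q ->
      q0 + g q0 / x0 <= q - g q / Derive g q + 2 * (g q0 / sqrt x0) / sqrt (Derive g q)).
    { intros q Hq. rewrite <- E0. apply ratio_incr_support; try assumption; lra. }
    split.
    + assert (E : conjugate g Q x0 = q0 * x0 - g q0).
      { apply Rle_antisym; [|apply Hub; lra]. apply Hl.
        assert (Hm : forall q, 0 < q -> g q0 - x0 * q0 <= g q - x0 * q).
        { apply (min_of_derive_sign (fun q => g q - x0 * q) (fun q => Derive g q - x0)); [lra| |].
          - intros q Hq. auto_derive; [apply H1; assumption|].
            change (Derive (fun x : R => g x) q) with (Derive g q). ring.
          - intros q Hq. rewrite <- E0. destruct (Rtotal_order q q0) as [H|[->|H]].
            + pose proof (Hi q q0 Hq H). nra.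
            + lra.
            + pose proof (Hi q0 q ltac:(lra) H). nra. }
        intros q [[Hq| <-] _]; [pose proof (Hm q Hq); lra|].
        (* The competitor [q = 0] is compared with [q0] through positive points near 0. *)
        rewrite g0. apply Rnot_lt_le. intros Hlt.
        destruct (small_near_zero g (- x0) (g q0 - x0 * q0) 1 Hc g0) as [p [Hp Hs]]; [lra|lra|].
        apply Rabs_def2 in Hs. pose proof (Hm p (proj1 Hp)). lra. }
      rewrite E. field. lra.
    + intros x Hx. assert (Sx : 0 < sqrt x) by (apply sqrt_lt_R0; lra).
      assert (Ex := sqrt_sqrt x ltac:(lra)).
      destruct (marginal_dichotomy g Q x H2 HQ1 (proj2 Hx)) as [Hflat|[q [Hq E]]].
      * apply Rle_trans with 0; [|apply Hpos].
        assert (Hlim : q0 + g q0 / x0 <= 2 * (g q0 / sqrt x0) / sqrt x).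
        (* The slack of [le_epsilon] is taken as the quantity [q] in [Hsup], which amounts to
           letting [q] tend to 0 with [Derive g q >= x]. *)
        { apply le_epsilon. intros q Hq. eapply Rle_trans; [apply (Hsup q Hq)|].
          assert (0 <= g q / Derive g q).
          { apply Rmult_le_pos; [apply Hg; lra|]. apply Rlt_le, Rinv_0_lt_compat, D1, Hq. }
          assert (2 * (g q0 / sqrt x0) / sqrt (Derive g q) <= 2 * (g q0 / sqrt x0) / sqrt x).
          { apply Rmult_le_compat_l.
            - assert (0 <= g q0 / sqrt x0); [|lra]. apply Rmult_le_pos; [apply Hg; lra|].
              apply Rlt_le, Rinv_0_lt_compat, S0.
            - apply Rinv_le_contravar; [assumption|]. apply sqrt_le_1_alt, Hflat, Hq. }
          lra. }
        apply (Rmult_le_compat_r x) in Hlim; [|lra].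
        replace (2 * (g q0 / sqrt x0) / sqrt x * x) with (2 * (g q0 / sqrt x0) * sqrt x) in Hlim.
        { lra. }
        rewrite <- Ex at 3. field. lra.
      * eapply Rle_trans; [|apply (Hub x q); lra].
        pose proof (Hsup q (proj1 Hq)) as Hs. rewrite E in Hs.
        apply (Rmult_le_compat_r x) in Hs; [|lra].
        replace ((q - g q / x + 2 * (g q0 / sqrt x0) / sqrt x) * x)
          with (q * x - g q + 2 * (g q0 / sqrt x0) * sqrt x) in Hs.
        { lra. }
        set (s := sqrt x) in *. set (c := g q0 / sqrt x0). rewrite <- Ex. field. lra.
Qed.

(** * From the buyer's utility to power means *)

(** Beyond [Q] marginal cost exceeds 1, hence also the marginal value [(1 - theta) ^ (k - 1)], so
    restricting to [q <= Q] does not change the supremum. *)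
Lemma max_virtual_surplus_conjugate (g : R -> R) (alpha Q : R) (k : nat) (theta : R) :
  (forall q, 0 <= q -> 0 <= g q) -> (forall q, 0 < q -> ex_derive g q) ->
  0 < Q -> (forall q, Q < q -> 1 < Derive g q) -> 0 <= theta <= 1 ->
  max_virtual_surplus g alpha k theta =
  conjugate g Q ((1 - theta) ^ (k - 1)) - 2 * alpha * theta * (1 - theta) ^ (k - 1).
Proof.
  intros Hg H1 HQ HQ1 Ht. set (x := (1 - theta) ^ (k - 1)).
  assert (Hx : 0 <= x <= 1).
  { unfold x. split; [apply pow_le; lra|].
    apply Rle_trans with (1 ^ (k - 1)); [apply pow_incr; lra|rewrite pow1; lra]. }
  destruct (conjugate_lub g Q x ltac:(lra) Hg) as [Hub Hl].
  unfold max_virtual_surplus. fold x.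
  rewrite (is_lub_Rbar_unique _ (Finite (conjugate g Q x - 2 * alpha * theta * x))); [reflexivity|].
  split.
  - intros v [q [Hq ->]]. simpl.
    enough (q * x - g q <= conjugate g Q x) by lra.
    destruct (Rle_lt_dec q Q) as [HqQ|HqQ]; [apply Hub; lra|].
    apply Rle_trans with (Q * x - g Q); [|apply Hub; lra].
    destruct (derive_mvt g (Derive g) Q q HqQ) as [c [Hc E]].
    { intros y Hy. apply Derive_correct, H1; lra. }
    pose proof (HQ1 c (proj1 Hc)). nra.
  - intros [b| |] Hb.
    + simpl. enough (conjugate g Q x <= b + 2 * alpha * theta * x) by lra.
      apply Hl. intros q Hq.
      assert (H := Hb ((q - 2 * alpha * theta) * x - g q)). simpl in H.
      enough ((q - 2 * alpha * theta) * x - g q <= b) by lra.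
      apply H. exists q. split; [lra|reflexivity].
    + exact I.
    + apply (Hb ((0 - 2 * alpha * theta) * x - g 0)). exists 0. split; [lra|reflexivity].
Qed.

Lemma is_RInt_virtual_cost (m : nat) :
  is_RInt (fun t => t * (1 - t) ^ m) 0 1 (/ INR (S m) - / INR (m + 2)).
Proof.
  assert (Hn : INR (S m) <> 0) by (apply not_0_INR; lia).
  assert (Hn2 : INR (S (S m)) <> 0) by (apply not_0_INR; lia).
  set (F := fun t => (1 - t) ^ S (S m) / INR (S (S m)) - (1 - t) ^ S m / INR (S m)).
  assert (H : is_RInt (fun t => t * (1 - t) ^ m) 0 1 (minus (F 1) (F 0))).
  { apply (is_RInt_derive (V := R_CompleteNormedModule) F).
    - intros x _. unfold F. auto_derive; [easy|].
      change (1 + - x) with (1 - x). simpl in Hn, Hn2. field. split; assumption.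
    - intros x _. apply (ex_derive_continuous (K := R_AbsRing) (V := R_NormedModule)).
      auto_derive. easy. }
  replace (/ INR (S m) - / INR (m + 2)) with (minus (F 1) (F 0)); [exact H|].
  change (F 1 - F 0 = / INR (S m) - / INR (m + 2)). unfold F.
  replace (m + 2)%nat with (S (S m)) by lia.
  rewrite Rminus_0_r, !pow1, Rminus_diag, !pow_i by lia. field. split; assumption.
Qed.

Lemma buyer_utility_power_mean (g : R -> R) (alpha Q : R) (m : nat) :
  (forall q, 0 <= q -> 0 <= g q) -> (forall q, 0 < q -> ex_derive g q) ->
  0 < Q -> (forall q, Q < q -> 1 < Derive g q) ->
  buyer_utility g alpha (S m) = power_mean (conjugate g Q) m - 2 * alpha / INR (m + 2).
Proof.
  intros Hg H1 HQ HQ1. set (h := conjugate g Q).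
  assert (Hh : is_RInt (fun t => h ((1 - t) ^ m)) 0 1 (RInt (fun t => h (t ^ m)) 0 1)).
  { assert (Hi := RInt_correct (V := R_CompleteNormedModule) _ _ _
      (ex_RInt_comp_pow h m (fun x => conjugate_continuous g Q x ltac:(lra) Hg))).
    (* The reflection [t |-> 1 - t] reverses the bounds; the swap and the later [opp] compensate. *)
    apply is_RInt_swap in Hi.
    assert (Hc : is_RInt (fun t => h (t ^ m)) (- 1 * 0 + 1) (- 1 * 1 + 1)
      (opp (RInt (fun t => h (t ^ m)) 0 1))).
    { replace (- 1 * 0 + 1) with 1 by ring. replace (- 1 * 1 + 1) with 0 by ring. exact Hi. }
    apply (is_RInt_comp_lin (V := R_NormedModule)) in Hc.
    apply (is_RInt_opp (V := R_NormedModule)) in Hc. rewrite opp_opp in Hc.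
    eapply is_RInt_ext; [|exact Hc]. intros t _.
    change (- (- 1 * h ((- 1 * t + 1) ^ m)) = h ((1 - t) ^ m)).
    replace (- 1 * t + 1) with (1 - t) by ring. ring. }
  assert (H := is_RInt_minus _ _ _ _ _ _ Hh
    (is_RInt_scal _ _ _ (2 * alpha) _ (is_RInt_virtual_cost m))).
  apply (is_RInt_unique (V := R_CompleteNormedModule)) in H.
  unfold buyer_utility, power_mean.
  rewrite (RInt_ext _ (fun t => h ((1 - t) ^ m) - 2 * alpha * (t * (1 - t) ^ m))).
  - transitivity (INR (S m) * (RInt (fun t => h (t ^ m)) 0 1
      - 2 * alpha * (/ INR (S m) - / INR (m + 2)))).
    { f_equal. exact H. }
    rewrite plus_INR, !S_INR. pose proof (pos_INR m). simpl. field. lra.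
  - rewrite Rmin_left, Rmax_right by lra. intros t Ht.
    rewrite (max_virtual_surplus_conjugate g alpha Q) by (assumption || lra).
    replace (S m - 1)%nat with m by lia. fold h. now rewrite Rmult_assoc.
Qed.

Theorem proposition13 (n : nat) (alpha : R) (g : R -> R)
  (n_pos : (1 <= n)%nat)
  (alpha_pos : 0 < alpha)
  (g_cont0 : filterlim g (at_right 0) (locally (g 0)))
  (g_diff : forall q : R, 0 < q -> ex_derive g q)
  (g_diff2 : forall q : R, 0 < q -> ex_derive (Derive g) q)
  (g_deriv_pos : forall q : R, 0 < q -> 0 < Derive g q)
  (g_deriv2_pos : forall q : R, 0 < q -> 0 < Derive (Derive g) q)
  (g_deriv_large : exists Q : R, forall q : R, Q < q -> 1 < Derive g q)
  (g_0 : g 0 = 0)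
  (g_deriv_incr : forall p q : R, 0 < p -> p < q -> Derive g p < Derive g q)
  (g_ratio_incr : forall p q : R, 0 < p -> p < q ->
     g p / sqrt (Derive g p) < g q / sqrt (Derive g q)) :
  quasi_convex_between 1 n (buyer_utility g alpha) /\
  exists kstar : nat, (kstar = 1%nat \/ kstar = n) /\
    forall k : nat, (1 <= k)%nat -> (k <= n)%nat ->
      buyer_utility g alpha k <= buyer_utility g alpha kstar.
Proof.
  destruct g_deriv_large as [Q0 HQ0].
  set (Q := Rmax Q0 1).
  assert (HQ : 1 <= Q) by apply Rmax_r.
  assert (HQ1 : forall q, Q < q -> 1 < Derive g q).
  { intros q Hq. apply HQ0. pose proof (Rmax_l Q0 1). fold Q in H. lra. }
  assert (Hg : forall q, 0 <= q -> 0 <= g q).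
  { intros q Hq. rewrite <- (Rmult_0_l q). apply slope_le_growth; try assumption.
    intros; apply Rlt_le, g_deriv_pos; assumption. }
  assert (qc : quasi_convex_between 1 n (buyer_utility g alpha)).
  { intros i j k Hi Hij Hjk Hk.
    destruct (Nat.eq_dec i j) as [<-|Nij]; [apply Rmax_l|].
    destruct (Nat.eq_dec j k) as [<-|Njk]; [apply Rmax_r|].
    destruct i as [|i]; [lia|]. destruct j as [|j]; [lia|]. destruct k as [|k]; [lia|].
    rewrite !(buyer_utility_power_mean g alpha Q) by (assumption || lra).
    set (h := conjugate g Q).
    assert (Pi := pos_INR i).
    assert (Lij : INR i < INR j) by (apply lt_INR; lia).
    assert (Ljk : INR j < INR k) by (apply lt_INR; lia).
    (* The weights solve [l1 + l3 = 1] and [EL]. Since [i], [j], [k] are now numbers of firms minus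
       one, [i + 2] is the number of firms plus one. *)
    set (l1 := INR (i + 2) * (INR k - INR j) / (INR (j + 2) * (INR k - INR i))).
    set (l3 := INR (k + 2) * (INR j - INR i) / (INR (j + 2) * (INR k - INR i))).
    assert (E2 : forall a, INR (a + 2) = INR a + 2) by (intros; rewrite plus_INR; reflexivity).
    assert (P1 : 0 < l1).
    { unfold l1. rewrite !E2. apply Rdiv_lt_0_compat; apply Rmult_lt_0_compat; lra. }
    assert (P3 : 0 < l3).
    { unfold l3. rewrite !E2. apply Rdiv_lt_0_compat; apply Rmult_lt_0_compat; lra. }
    assert (S13 : l1 + l3 = 1) by (unfold l1, l3; rewrite !E2; field; lra).
    assert (EL : l1 / INR (i + 2) + l3 / INR (k + 2) = / INR (j + 2))
      by (unfold l1, l3; rewrite !E2; field; lra).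
    assert (H := power_mean_convex h i j k l1 l3
      (fun x => conjugate_continuous g Q x ltac:(lra) Hg)
      (conjugate_sqrt_convex g Q ltac:(assumption) ltac:(assumption) ltac:(assumption)
        ltac:(assumption) ltac:(assumption) ltac:(assumption) ltac:(assumption)
        ltac:(assumption) ltac:(lra) ltac:(assumption))
      ltac:(lia) ltac:(lia) P1 P3 S13 EL).
    set (x := power_mean h i - 2 * alpha / INR (i + 2)).
    set (z := power_mean h k - 2 * alpha / INR (k + 2)).
    (* The cost term is linear in [1 / (m + 2)], so by [EL] it combines with equality. *)
    assert (power_mean h j - 2 * alpha / INR (j + 2) <= l1 * x + l3 * z).
    { unfold x, z. unfold Rdiv at 1. rewrite <- EL. unfold Rdiv. lra. }
    pose proof (Rmax_l x z). pose proof (Rmax_r x z).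
    replace l3 with (1 - l1) in * by lra. nra. }
  split; [exact qc|].
  destruct (Rle_lt_dec (buyer_utility g alpha 1) (buyer_utility g alpha n)) as [H|H].
  - exists n. split; [now right|]. intros k Hk1 Hkn.
    rewrite <- (Rmax_right _ _ H). apply qc; lia.
  - exists 1%nat. split; [now left|]. intros k Hk1 Hkn.
    rewrite <- (Rmax_left (buyer_utility g alpha 1) (buyer_utility g alpha n)) by lra.
    apply qc; lia.
Qed.
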